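(* Let $V,W$ be locally convex metric vector spaces and let $V$ be strict. Then the sets $K_j$ ($j\in\mathbb{N}$) together with their geometric multiples $2^{-n}K_j$ ($n,j\in\mathbb{N}$) form a countable base of zero neighborhoods of a Hausdorff topological vector space topology $t$ on $TL(V,W)$ (which is therefore metrizable), and for all $r,b\in\mathbb{N}$ this topology $t$ is coarser than the topology of $T_{r,b}L(V,W)$, i.e., if $A_n\to A$ in $T_{r,b}L(V,W)$, then $A_n\to A$ in $TL(V,W)$.
   Context: A metric vector space is a real vector space $V$ with a translation-invariant metric $d$ inducing a vector space topology. It is strict if $S(v):=\sup_{r>0} d(rv,0)/r<\infty$ for all $v\in V$. Put $c(n):=\overline{\mathrm{conv}}(B^V_{2^{-n}}(0))$ and $C(n):=\overline{\mathrm{conv}}(B^W_{2^{-n}}(0))$ (closed convex hulls of metric balls). For a subset $S\subset W$ put $\mu_n(S):=\inf\{r>0: S\subset r\,C(n)\}\in[0,\infty]$; for $w\in W$ put $\mu_n(w):=\mu_n(\{w\})$, and define $\mu_n$ on $V$ analogously with $c(n)$. $CL(V,W)$ is the space of continuous linear maps. For $r,b\in\mathbb{N}$ (with $0\in\mathbb{N}$), $T_{r,b}L(V,W)$ is the set of $f\in CL(V,W)$ for which there are real $K_n$ with $\mu_n(f(v))\le K_n\,\mu_{n+r}(v)$ for all $v\in V$ and all $n\ge b$. $T_rL(V,W):=\bigcup_b T_{r,b}L(V,W)$ and $TL(V,W):=\bigcup_{r}T_rL(V,W)$ (tame linear maps). The topology of $T_{r,b}L(V,W)$ is the one induced by the seminorms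 $\|A\|_M:=\mu_M(A(c(M+r)))$, $M\ge b$, i.e. by the metric $\sum_{M\ge b}2^{-M}\frac{\|A-B\|_M}{1+\|A-B\|_M}$. For $A\in TL(V,W)$ put $\|A\|_{i,j}:=\mu_j(A(c(i)))\in[0,\infty]$, $K_{i,j}:=\{A\in TL(V,W):\|A\|_{i,j}<2^{-i}\}$ and $K_j:=\bigcup_{i=1}^\infty K_{i,j}$. *)

(* Defs.v *)
From HB Require Import structures.
From mathcomp Require Import all_boot all_order all_algebra.
From mathcomp Require Import all_classical all_reals.
From mathcomp Require Import interval_inference ereal topology normedtype.
From mathcomp Require Import sequences convex.
From mathcomp Require Import lra.

Set Implicit Arguments.
Unset Strict Implicit.
Unset Printing Implicit Defensive.

Import Order.TTheory GRing.Theory Num.Theory.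
Import numFieldNormedType.Exports.

Local Open Scope classical_set_scope.
Local Open Scope ring_scope.

(* The library's [metricType] cannot be joined with [topologicalLmodType] in
   the present hierarchy, so the metric is an extra field on a topological
   vector space, tied to its topology by [nbhs_dist]. *)
HB.mixin Record hasInvariantMetric (R : numDomainType) V
    & TopologicalLmodule R V := {
  dist : V -> V -> R ;
  distxx : forall x, dist x x = 0 ;
  dist_eq0 : forall x y, dist x y = 0 -> x = y ;
  dist_sym : forall x y, dist x y = dist y x ;
  dist_triangle : forall y x z, dist x z <= dist x y + dist y z ;
  distDr : forall z x y, dist (x + z) (y + z) = dist x y ;
  nbhs_dist : forall x : V, nbhs x =
    filter_from [set e : R | 0 < e] (fun e => [set y | dist x y < e])
}.

#[short(type="metricVectType")]
HB.structure Definition MetricVector (R : numDomainType) :=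
  {V of TopologicalLmodule R V & hasInvariantMetric R V}.

(* [Tvs] is the library's class of locally convex topological vector spaces. *)
#[short(type="lcMetricVectType")]
HB.structure Definition LCMetricVector (R : numDomainType) :=
  {V of MetricVector R V & Tvs R V}.

Section ConvexHull.
Context (R : realType).

Definition conv_hull (E : lmodType R) (A : set E) : set E :=
  \bigcap_(C in [set C | convex_set C /\ A `<=` C]) C.

Lemma convex_setP (E : lmodType R) (A : set E) :
  convex_set A <-> forall (t : R) x y, 0 <= t <= 1 -> A x -> A y ->
    A (t *: x + (1 - t) *: y).
Proof.
split=> [cA t x y t01 Ax Ay|cA x y l].
  have /andP[t0 t1] := t01.
  pose l : {i01 R} := Itv01 t0 t1.
  have := cA x y l; rewrite !inE => /(_ Ax Ay).
  by [].
rewrite !inE => Ax Ay; apply: cA => //.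
by rewrite ge0 le1.
Qed.

Lemma sub_conv_hull (E : lmodType R) (A : set E) : A `<=` conv_hull A.
Proof. by move=> x Ax C [_]; exact. Qed.

Lemma conv_hull_convex (E : lmodType R) (A : set E) : convex_set (conv_hull A).
Proof.
apply/convex_setP => t x y t01 hx hy C [cC AC].
by move/convex_setP: (cC); apply => //; [exact: hx|exact: hy].
Qed.

Lemma conv_hull_min (E : lmodType R) (A C : set E) :
  convex_set C -> A `<=` C -> conv_hull A `<=` C.
Proof. by move=> cC AC x; apply. Qed.

Lemma cvg_scaler (E : topologicalLmodType R) (a : R) (x : E) :
  a *: y @[y --> x] --> a *: x.
Proof.
apply: (@continuous_comp E (R^o * E)%type E (fun y => (a, y))
  (fun z => z.1 *: z.2)); last exact: scale_continuous.
by apply: (@cvg_pair _ _ _ _ (nbhs (a : R^o))); [exact: cvg_cst|exact: cvg_id].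
Qed.

Lemma cvg_addr (E : topologicalLmodType R) (T : Type) (F : set_system T)
    (FF : Filter F) (f g : T -> E) (x y : E) :
  f @ F --> x -> g @ F --> y -> f t + g t @[t --> F] --> x + y.
Proof.
move=> fx gy; apply: (@continuous2_cvg _ _ _ _ _ _ _ _ (fun u v : E => u + v) x y) => //.
exact: (@add_continuous E (x, y)).
Qed.

Lemma closure_convex (E : topologicalLmodType R) (A : set E) :
  convex_set A -> convex_set (closure A).
Proof.
move=> /convex_setP cA; apply/convex_setP => t x y t01 Ax Ay B zB.
have : t *: p.1 + (1 - t) *: p.2 @[p --> (x, y)] --> t *: x + (1 - t) *: y.
  apply: cvg_addr.
    exact: (@cvg_comp _ _ _ fst ( *:%R t) (nbhs (x,y)) (nbhs x) _ (@cvg_fst _ _ _ _ _) (@cvg_scaler _ t x)).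
  exact: (@cvg_comp _ _ _ snd ( *:%R (1 - t)) (nbhs (x,y)) (nbhs y) _ (@cvg_snd _ _ _ _ _) (@cvg_scaler _ (1-t) y)).
move=> /(_ B zB) [[P Q] /= [xP yQ] PQB].
have [a [Aa Pa]] := Ax P xP.
have [b [Ab Qb]] := Ay Q yQ.
exists (t *: a + (1 - t) *: b); split; first exact: cA.
exact: (PQB (a, b)).
Qed.

End ConvexHull.

Section Mu.
Context (R : realType).

(* c(n) on V and C(n) on W *)
Definition ccball (E : metricVectType R) (n : nat) : set E :=
  closure (conv_hull [set v : E | dist v 0 < 2^-1 ^+ n]).
Arguments ccball E n _ : clear implicits.

Definition mu (E : metricVectType R) (n : nat) (S : set E) : \bar R :=
  ereal_inf [set r%:E | r in [set r : R | 0 < r /\ S `<=` *:%R r @` ccball E n]].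

Definition strict_metric (E : metricVectType R) := forall v : E,
  (ereal_sup [set (dist (r *: v) 0 / r)%:E | r in [set r : R | (0 < r)%R]] < +oo)%E.

Context (E : metricVectType R).
Implicit Types (n : nat) (x y z : E) (S T U : set E).

Lemma ccball_convex n (t : R) x y : 0 <= t <= 1 ->
  ccball E n x -> ccball E n y -> ccball E n (t *: x + (1 - t) *: y).
Proof.
move: t x y; apply/convex_setP.
exact/closure_convex/conv_hull_convex.
Qed.

Lemma sub_ccball n x : dist x 0 < 2^-1 ^+ n -> ccball E n x.
Proof. by move=> xn; apply: subset_closure; exact: sub_conv_hull. Qed.

Lemma ccball0 n : ccball E n 0.
Proof. by apply: sub_ccball; rewrite distxx exprn_gt0// invr_gt0. Qed.

Lemma ccball_le m n : (m <= n)%N -> ccball E n `<=` ccball E m.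
Proof.
move=> mn; apply: closure_subset; apply: conv_hull_min.
  exact: conv_hull_convex.
move=> x /= xn; apply: sub_conv_hull; apply: (lt_le_trans xn).
by rewrite ler_wiXn2l// ?invr_ge0// invf_le1// ler1n.
Qed.

Lemma distN x : dist (- x) 0 = dist x 0.
Proof. by rewrite -(distDr x) addNr add0r dist_sym. Qed.

Lemma ccballN n x : ccball E n x -> ccball E n (- x).
Proof.
move=> nx B xB.
have /nx [a [Ca Ba]] : nbhs x [set y | B (- y)].
  have : nbhs x (( *:%R (-1)) @^-1` B).
    by apply: (@cvg_scaler _ E (-1) x B); rewrite scaleN1r.
  rewrite (_ : _ @^-1` B = [set y | B (- y)])//.
  by apply/seteqP; split=> y /=; rewrite scaleN1r.
exists (- a); split => //.
have : convex_set [set y | conv_hull [set v : E | dist v 0 < 2^-1 ^+ n] (- y)].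
  apply/convex_setP => t u v t01 /= hu hv.
  rewrite opprD -!scalerN.
  have /convex_setP := @conv_hull_convex _ _ [set v : E | dist v 0 < 2^-1 ^+ n].
  exact.
move=> cC; move: a Ca {Ba}; apply: conv_hull_min => // y /= yn.
by apply: sub_conv_hull => /=; rewrite distN.
Qed.

Lemma ccball_star n (t : R) x : 0 <= t <= 1 -> ccball E n x -> ccball E n (t *: x).
Proof.
move=> t01 nx; have := ccball_convex t01 nx (ccball0 n).
by rewrite scaler0 addr0.
Qed.

Lemma ccball_balanced n (t : R) x : `|t| <= 1 -> ccball E n x -> ccball E n (t *: x).
Proof.
move=> t1 nx; have [t0|t0] := leP 0 t.
  by apply: ccball_star => //; rewrite t0 -(ger0_norm t0).
rewrite -[t]opprK scaleNr; apply: ccballN; apply: ccball_star => //.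
by rewrite oppr_ge0 ltW//= -ltr0_norm.
Qed.

Lemma ccball_absorb n x : exists2 s : R, 0 < s & ccball E n (s *: x).
Proof.
have := @scale_continuous R E (0, x) [set v : E | dist v 0 < 2^-1 ^+ n].
rewrite /= scale0r => /(_ _)[|[P Q] /= [P0 Qx] PQ].
  rewrite nbhs_dist; exists (2^-1 ^+ n); first by rewrite /= exprn_gt0// invr_gt0.
  by move=> y /=; rewrite dist_sym.
move: P0; rewrite -nbhs_ballE => -[e /= e0 eP].
exists (e / 2); first by rewrite divr_gt0.
apply: sub_ccball; apply: (PQ (e / 2, x)); split => /=.
  apply: eP; rewrite /ball/= sub0r normrN gtr0_norm ?divr_gt0//.
  by rewrite ltr_pdivrMr// ltr_pMr// ltr1n.
exact: nbhs_singleton.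
Qed.

Lemma mu_ge0 n S : (0 <= mu n S)%E.
Proof.
by apply: le_ereal_inf_tmp => _ [r /= [r0 _] <-]; rewrite lee_fin ltW.
Qed.

Lemma mu_ltP n S (r : R) : (mu n S < r%:E)%E ->
  0 < r /\ forall x, S x -> ccball E n (r^-1 *: x).
Proof.
move=> /ereal_inf_lt[_ [s /= [s0 Ss] <-]]; rewrite lte_fin => sr.
have r0 : 0 < r by exact: lt_trans sr.
split=> // x /Ss[c nc <-]; rewrite scalerA; apply: ccball_star => //.
rewrite mulr_ge0 ?invr_ge0 ?(ltW r0) ?(ltW s0)//= mulrC ler_pdivrMr//.
by rewrite mul1r ltW.
Qed.

Lemma mu_le n S (r : R) : 0 < r -> (forall x, S x -> ccball E n (r^-1 *: x)) ->
  (mu n S <= r%:E)%E.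
Proof.
move=> r0 Sr; apply: ge_ereal_inf; exists r%:E => //; exists r => //; split=> //.
move=> x /Sr ?; exists (r^-1 *: x) => //.
by rewrite scalerA mulfV ?scale1r// gt_eqF.
Qed.

Lemma mu1_fin n x : mu n [set x] \is a fin_num.
Proof.
rewrite ge0_fin_numE ?mu_ge0//.
have [s s0 ns] := ccball_absorb n x.
apply: (@le_lt_trans _ _ (s^-1)%:E); last exact: ltry.
apply: mu_le; first by rewrite invr_gt0.
by move=> _ ->; rewrite invrK.
Qed.

Lemma mu_mono m n S : (m <= n)%N -> (mu m S <= mu n S)%E.
Proof.
move=> mn; apply: ereal_inf_le_tmp => _ [r /= [r0 Sr] <-]; exists r => //; split=> //.
by apply: (subset_trans Sr); apply: image_subset; exact: ccball_le.
Qed.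

Lemma muD n U S T : (forall z, U z -> exists x y, [/\ S x, T y & z = x + y]) ->
  (mu n U <= mu n S + mu n T)%E.
Proof.
move=> UST.
have [->|Sfin] := eqVneq (mu n S) +oo%E.
  by rewrite addye ?leey// gt_eqF// (lt_le_trans _ (mu_ge0 n T))// ltNy0.
have [->|Tfin] := eqVneq (mu n T) +oo%E.
  by rewrite addey ?leey// gt_eqF// (lt_le_trans _ (mu_ge0 n S))// ltNy0.
have {}Sfin : mu n S \is a fin_num by rewrite ge0_fin_numE ?mu_ge0// ltey.
have {}Tfin : mu n T \is a fin_num by rewrite ge0_fin_numE ?mu_ge0// ltey.
apply/lee_addgt0Pr => e e0.
have e20 : 0 < e / 2 by rewrite divr_gt0.
set s := fine (mu n S) + e / 2; set t := fine (mu n T) + e / 2.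
have /mu_ltP[s0 Ss] : (mu n S < s%:E)%E.
  by rewrite -[mu n S]fineK// lte_fin ltrDl.
have /mu_ltP[t0 Tt] : (mu n T < t%:E)%E.
  by rewrite -[mu n T]fineK// lte_fin ltrDl.
have st0 : 0 < s + t by rewrite addr_gt0.
have -> : (mu n S + mu n T + e%:E)%E = (s + t)%:E.
  rewrite -[mu n S]fineK// -[mu n T]fineK// -!EFinD; congr _%:E.
  by rewrite /s /t; lra.
apply: mu_le => // z /UST[x [y [Sx Ty ->]]].
have := @ccball_convex n (s / (s + t)) _ _ _ (Ss x Sx) (Tt y Ty).
have -> : 1 - s / (s + t) = t / (s + t).
  by rewrite -[X in X - _](@divff _ (s + t)) ?gt_eqF// -mulrBl addrAC subrr add0r.
rewrite !scalerA mulrAC divff ?gt_eqF// mul1r mulrAC divff ?gt_eqF// mul1r.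
rewrite -scalerDr; apply.
by rewrite divr_ge0 ?(ltW s0) ?(ltW st0)//= ler_pdivrMr// mul1r lerDl ltW.
Qed.

Lemma muZ n (a : R) U S : mu n S \is a fin_num ->
  (forall z, U z -> exists2 x, S x & z = a *: x) ->
  (mu n U <= `|a|%:E * mu n S)%E.
Proof.
move=> Sfin US; apply/lee_addgt0Pr => e e0.
have a1 : 0 < `|a| + 1 by rewrite ltr_wpDl.
set d := e / 2 / (`|a| + 1).
have d0 : 0 < d by rewrite !divr_gt0.
set s := fine (mu n S) + d.
have /mu_ltP[s0 Ss] : (mu n S < s%:E)%E.
  by rewrite -[mu n S]fineK// lte_fin ltrDl.
set r := `|a| * s + e / 2.
have r0 : 0 < r by rewrite ltr_wpDl ?divr_gt0// mulr_ge0 ?normr_ge0 ?ltW.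
apply: (@le_trans _ _ r%:E).
  apply: mu_le => // z /US[x Sx ->].
  have := @ccball_balanced n (a * s / r) _ _ (Ss x Sx).
  rewrite !scalerA [a * s / r / s]mulrAC mulfK ?gt_eqF//.
  rewrite [r^-1 * a]mulrC; apply.
  rewrite !normrM normfV (gtr0_norm s0) (gtr0_norm r0) ler_pdivrMr// mul1r.
  by rewrite /r lerDl ltW// divr_gt0.
rewrite -[mu n S]fineK// -EFinM -EFinD lee_fin /r /s mulrDr -addrA lerD2l.
have -> : e = e / 2 + e / 2 by lra.
rewrite [in leLHS](_ : (e / 2 + e / 2) / 2 = e / 2); last by lra.
rewrite lerD2r /d mulrA ler_pdivrMr// mulrC ler_wpM2l ?lerDl//.
by rewrite divr_ge0// ltW.
Qed.

Lemma mu0 n : mu n [set (0 : E)] = 0%E.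
Proof.
apply/eqP; rewrite eq_le mu_ge0 andbT; apply/lee_addgt0Pr => e e0.
rewrite add0e; apply: mu_le => // x ->; rewrite scaler0; exact: ccball0.
Qed.

End Mu.
Arguments ccball {R} E n _.

Section TameMaps.
Context (R : realType) (V W : metricVectType R).

Definition opnorm (i j : nat) (f : V -> W) : \bar R := mu j (f @` ccball V i).

Definition CL : set (V -> W) := [set f | linear f /\ continuous f].

Definition tame_rb (r b : nat) : set (V -> W) := [set f | CL f /\
  exists K : nat -> R, forall n, (b <= n)%N -> forall v : V,
    (mu n [set f v] <= (K n)%:E * mu (n + r) [set v])%E].

Definition tame_r (r : nat) : set (V -> W) := \bigcup_b tame_rb r b.

Definition tame : set (V -> W) := \bigcup_r tame_r r.

Definition tame_rb_pred (r b : nat) : {pred V -> W} := mem (tame_rb r b).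

Definition tame_pred : {pred V -> W} := mem tame.

Lemma CL_submod_closed : submod_closed (mem CL : {pred V -> W}).
Proof.
split=> [|a f g]; rewrite !inE.
  split=> [k x y|x]; first by rewrite [RHS]addr0 scaler0.
  exact: (@cst_continuous V W 0).
move=> [lf cf] [lg cg]; split=> [k x y|x].
  have E z : (a *: f + g) z = a *: f z + g z by [].
  rewrite !E lf lg.
  rewrite !scalerDr !scalerA mulrC -!addrA; congr (_ + _).
  by rewrite addrCA.
apply: cvg_addr; last exact: cg.
exact: (@cvg_comp _ _ _ f ( *:%R a) _ (nbhs (f x)) _ (cf x) (@cvg_scaler _ W a _)).
Qed.

Lemma tame_rb_submod_closed r b : submod_closed (tame_rb_pred r b).
Proof.
have [CL0 CLD] := CL_submod_closed.
split=> [|a f g]; rewrite !inE.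
  split; first by rewrite inE in CL0.
  by exists (cst 0) => n bn v; rewrite mul0e mu0.
move=> [Cf [K fK]] [Cg [L gL]]; split.
  have := CLD a f g; rewrite !inE; exact.
exists (fun n => `|a| * K n + L n) => n bn v.
apply: (@le_trans _ _ (`|a|%:E * mu n [set f v] + mu n [set g v])%E).
  apply: (@le_trans _ _ (mu n [set a *: f v] + mu n [set g v])%E).
    by apply: muD => _ ->; exists (a *: f v), (g v).
  apply: leeD => //; apply: muZ; first exact: mu1_fin.
  by move=> _ ->; exists (f v).
have := fK n bn v; have := gL n bn v.
rewrite -(fineK (mu1_fin n (f v))) -(fineK (mu1_fin n (g v))).
rewrite -(fineK (mu1_fin (n + r) v)) -!EFinM !lee_fin => gv fv.
rewrite mulrDl lerD// -mulrA ler_wpM2l//.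
Qed.

Lemma tame_rb_le r b r' b' : (r <= r')%N -> (b <= b')%N ->
  tame_rb r b `<=` tame_rb r' b'.
Proof.
move=> rr' bb' f [Cf [K fK]]; split=> //; exists (fun n => `|K n|) => n bn v.
apply: (le_trans (fK n (leq_trans bb' bn) v)).
apply: (@le_trans _ _ (`|K n|%:E * mu (n + r) [set v])%E).
  by rewrite lee_wpmul2r ?mu_ge0// lee_fin ler_norm.
by rewrite lee_wpmul2l ?lee_fin// mu_mono// leq_add2l.
Qed.

Lemma tame_submod_closed : submod_closed tame_pred.
Proof.
split=> [|a f g]; rewrite !inE.
  exists 0%N => //; exists 0%N => //.
  by have [/[!inE]] := tame_rb_submod_closed 0 0.
move=> [r _ [b _ frb]] [r' _ [b' _ grb]].
exists (maxn r r') => //; exists (maxn b b') => //.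
have [_ /(_ a f g)] := tame_rb_submod_closed (maxn r r') (maxn b b').
rewrite !inE; apply.
  by apply: tame_rb_le frb; exact: leq_maxl.
by apply: tame_rb_le grb; exact: leq_maxr.
Qed.

HB.instance Definition _ r b :=
  GRing.isSubmodClosed.Build R (V -> W) (tame_rb_pred r b) (tame_rb_submod_closed r b).
HB.instance Definition _ :=
  GRing.isSubmodClosed.Build R (V -> W) tame_pred tame_submod_closed.

Record TrbL (r b : nat) := MkTrbL { TrbL_fun :> V -> W ; _ : TrbL_fun \in tame_rb_pred r b }.
HB.instance Definition _ r b := [isSub of TrbL r b for @TrbL_fun r b].
HB.instance Definition _ r b := [Choice of TrbL r b by <:].
HB.instance Definition _ r b := [SubChoice_isSubLmodule of TrbL r b by <:].

Record TL := MkTL { TL_fun :> V -> W ; _ : TL_fun \in tame_pred }.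
HB.instance Definition _ := [isSub of TL for TL_fun].
HB.instance Definition _ := [Choice of TL by <:].
HB.instance Definition _ := [SubChoice_isSubLmodule of TL by <:].

Lemma opnorm0 i j : opnorm i j 0 = 0%E.
Proof.
apply/eqP; rewrite eq_le mu_ge0 andbT; apply/lee_addgt0Pr => e e0.
rewrite add0e; apply: mu_le => // _ [x _ <-]; rewrite scaler0; exact: ccball0.
Qed.

Lemma opnormD i j (f g : V -> W) : (opnorm i j (f + g)%R <= opnorm i j f + opnorm i j g)%E.
Proof.
apply: muD => _ [x cx <-]; exists (f x), (g x).
by split=> //; exists x.
Qed.

Lemma opnormN i j (f : V -> W) : opnorm i j (- f) = opnorm i j f.
Proof.
suff H (g : V -> W) : (opnorm i j (- g)%R <= opnorm i j g)%E.
  by apply/eqP; rewrite eq_le H /= -{1}[f]opprK H.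
apply: ereal_inf_le_tmp => _ [r /= [r0 gr] <-]; exists r => //; split=> //.
move=> _ [x cx <-]; have [y cy yx] : (( *:%R r) @` ccball W j) (g x).
  by apply: gr; exists x.
by exists (- y); [exact: ccballN|rewrite scalerN yx].
Qed.

Lemma opnorm_fin r b M (f : V -> W) : tame_rb r b f -> (b <= M)%N ->
  opnorm (M + r) M f \is a fin_num.
Proof.
move=> [Cf [K fK]] bM; rewrite ge0_fin_numE ?mu_ge0//.
apply: (@le_lt_trans _ _ (`|K M| + 1)%:E); last exact: ltry.
apply: mu_le; first by rewrite ltr_wpDl.
move=> _ [x cx <-].
suff /mu_ltP[_] : (mu M [set f x] < (`|K M| + 1)%:E)%E by apply.
apply: (@le_lt_trans _ _ `|K M|%:E); last by rewrite lte_fin ltrDl.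
apply: (le_trans (fK M bM x)).
rewrite -[leRHS]mule1 (@le_trans _ _ (`|K M|%:E * mu (M + r) [set x])%E)//.
  by rewrite lee_wpmul2r ?mu_ge0// lee_fin ler_norm.
rewrite lee_wpmul2l ?lee_fin//; apply: mu_le => // _ ->.
by rewrite invr1 scale1r.
Qed.

Section TrbMetric.
Context (r b : nat).
Implicit Types A B C : TrbL r b.

Definition TrbL_norm (M : nat) A : \bar R := opnorm (M + r) M A.

(* The norms are finite by [opnorm_fin] and the sum by comparison with the
   geometric series, so the projections [fine] lose nothing. *)
Definition TrbL_dist A B : R :=
  fine (\sum_(b <= M <oo)
    (2^-1 ^+ M * (fine (TrbL_norm M (A - B)) / (1 + fine (TrbL_norm M (A - B)))))%R%:E)%E.

Let g (x : R) : R := x / (1 + x).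
Let term A B (M : nat) : \bar R := (2^-1 ^+ M * g (fine (TrbL_norm M (A - B))))%:E.

Let g_ge0 x : 0 <= x -> 0 <= g x.
Proof. by move=> x0; rewrite divr_ge0// addr_ge0. Qed.

Let g_le1 x : 0 <= x -> g x <= 1.
Proof. by move=> x0; rewrite ler_pdivrMr ?ltr_wpDr// mul1r lerDr. Qed.

Let gE x : 0 <= x -> g x = 1 - (1 + x)^-1.
Proof.
move=> x0; have x1 : 1 + x != 0 by rewrite gt_eqF// ltr_wpDr.
by apply: (mulIf x1); rewrite /g mulfVK// mulrBl mulVf// mul1r addrC addKr.
Qed.

Let g_subadd x y z : 0 <= x -> 0 <= y -> 0 <= z -> z <= x + y -> g z <= g x + g y.
Proof.
move=> x0 y0 z0 zxy; apply: (@le_trans _ _ (g (x + y))).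
  rewrite !gE ?addr_ge0// lerD2l lerN2 lef_pV2 ?posrE ?ltr_wpDr ?addr_ge0//.
  by rewrite lerD2l.
rewrite {1}/g mulrDl lerD// ler_wpM2l// lef_pV2 ?posrE ?ltr_wpDr ?addr_ge0//.
  by rewrite addrA lerDl.
by rewrite lerD2l lerDr.
Qed.

Let norm_ge0 M A : 0 <= fine (TrbL_norm M A).
Proof. by rewrite fine_ge0// mu_ge0. Qed.

Let term_ge0 A B M : (0 <= term A B M)%E.
Proof. by rewrite lee_fin mulr_ge0 ?exprn_ge0 ?invr_ge0 ?g_ge0. Qed.

Let halfsum n : \sum_(b <= M < n) 2^-1 ^+ M <= 2 - 2 * 2^-1 ^+ n :> R.
Proof.
elim: n => [|n ih]; first by rewrite big_geq// expr0; lra.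
have [bn|nb] := leqP b n.
  by rewrite big_nat_recr//= exprS; move: ih; lra.
rewrite big_geq// exprS.
have : (2^-1 : R) ^+ n <= 1 by rewrite exprn_ile1// ?invr_ge0// invf_le1// ler1n.
by lra.
Qed.

Let sum_fin A B : (\sum_(b <= M <oo) term A B M)%E \is a fin_num.
Proof.
rewrite ge0_fin_numE; last by apply: nneseries_ge0 => n _ _; exact: term_ge0.
apply: (@le_lt_trans _ _ 2%:E); last exact: ltry.
apply: lime_le; first by apply: is_cvg_nneseries => n _ _; exact: term_ge0.
apply: nearW => n; rewrite sumEFin lee_fin.
apply: (@le_trans _ _ (\sum_(b <= M < n) 2^-1 ^+ M)).
  apply: ler_sum => M _; rewrite ler_piMr ?exprn_ge0 ?invr_ge0//.
  exact: g_le1.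
apply: (le_trans (halfsum n)).
by rewrite gerBl mulr_ge0// exprn_ge0// invr_ge0.
Qed.

Lemma TrbL_distxx A : TrbL_dist A A = 0.
Proof.
rewrite /TrbL_dist eseries0// => M _ _.
by rewrite subrr /TrbL_norm opnorm0/= mul0r mulr0.
Qed.

Lemma TrbL_dist_sym A B : TrbL_dist A B = TrbL_dist B A.
Proof.
rewrite /TrbL_dist; congr fine; apply: eq_eseriesr => M _.
suff -> : TrbL_norm M (A - B) = TrbL_norm M (B - A) by [].
by rewrite -opprB /TrbL_norm -[RHS]opnormN.
Qed.

Let EFin_le_add (x y z : R) (X Y Z : \bar R) :
  x%:E = X -> y%:E = Y -> z%:E = Z -> (X <= Y + Z)%E -> x <= y + z.
Proof. by move=> <- <- <-. Qed.

Lemma TrbL_dist_triangle B A C : TrbL_dist A C <= TrbL_dist A B + TrbL_dist B C.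
Proof.
have distE A' B' : (TrbL_dist A' B')%:E = (\sum_(b <= M <oo) term A' B' M)%E.
  exact: fineK (sum_fin A' B').
apply: (EFin_le_add (distE A C) (distE A B) (distE B C)).
rewrite -nneseriesD; [|by move=> n _ _; exact: term_ge0..].
apply: lee_lim.
- by apply: is_cvg_nneseries => n _ _; exact: term_ge0.
- by apply: is_cvg_nneseries => n _ _; rewrite adde_ge0//; exact: term_ge0.
apply: nearW => n; rewrite [leLHS]big_nat_cond [leRHS]big_nat_cond.
apply: lee_sum => M /andP[/andP[bM _] _].
rewrite -EFinD lee_fin -mulrDr ler_wpM2l ?exprn_ge0 ?invr_ge0//.
apply: g_subadd => //.
have fin D : TrbL_norm M D \is a fin_num.
  by apply: opnorm_fin bM; have := valP D; rewrite inE.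
apply: (EFin_le_add (fineK (fin (A - C))) (fineK (fin (A - B)))
  (fineK (fin (B - C)))).
rewrite -[A - C](subrKA B).
exact: (opnormD (M + r) M (A - B : TrbL r b) (B - C : TrbL r b)).
Qed.

Let ball A (e : R) : set (TrbL r b) := [set B | TrbL_dist A B < e].
Let ent : set_system (TrbL r b * TrbL r b) := entourage_ ball.

Let nbhsE : nbhs_ ent = nbhs_ ent. Proof. by []. Qed.

HB.instance Definition _ := hasNbhs.Build (TrbL r b) (nbhs_ ent).

Let ball_center A (e : R) : 0 < e -> ball A e A.
Proof. by move=> e0; rewrite /ball/= TrbL_distxx. Qed.

Let ball_sym A B (e : R) : ball A e B -> ball B e A.
Proof. by rewrite /ball/= TrbL_dist_sym. Qed.

Let ball_triangle A B C e1 e2 : ball A e1 B -> ball B e2 C -> ball A (e1 + e2) C.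
Proof.
by rewrite /ball/= => ? ?; rewrite (le_lt_trans (TrbL_dist_triangle B _ _))// ltrD.
Qed.

Let entE : ent = entourage_ ball. Proof. by []. Qed.

HB.instance Definition _ := @Nbhs_isPseudoMetric.Build R (TrbL r b)
  ent nbhsE ball ball_center ball_sym ball_triangle entE.

Lemma TrbL_nbhsE A : nbhs A =
  filter_from [set e : R | 0 < e] (fun e => [set B | TrbL_dist A B < e]).
Proof. by rewrite -filter_from_ballE. Qed.

Lemma tame_rb_tame (f : V -> W) : f \in tame_rb_pred r b -> f \in tame_pred.
Proof. by rewrite !inE => fP; exists r => //; exists b. Qed.

Definition TrbL_TL A : TL := MkTL (tame_rb_tame (valP A)).

End TrbMetric.

Definition K_ij (i j : nat) : set TL :=
  [set A : TL | (opnorm i j A < (2^-1 ^+ i)%:E)%E].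

Definition K_j (j : nat) : set TL := \bigcup_(i in [set i | (1 <= i)%N]) K_ij i j.

Definition K_base : set_system TL :=
  [set N | exists n j : nat, N = *:%R (2^-1 ^+ n) @` K_j j].

End TameMaps.

(* A topology on the vector space E is given as an instance [t] of the
   library's class [Topological] on the carrier of E; the algebraic structure
   stays that of E. *)
Section VectorTopology.
Context (R : realType) (E : lmodType R) (t : Topological.axioms_ E).
Let T : topologicalType := Topological.Pack t.

Definition is_vector_topology :=
  continuous (fun z : T * T => (z.1 : E) + (z.2 : E) : T) /\
  continuous (fun z : R^o * T => z.1 *: (z.2 : E) : T).

End VectorTopology.

Definition metrizable (R : realType) (T : topologicalType) := exists d : T -> T -> R,
  [/\ forall x y, (d x y == 0) = (x == y),
      forall x y, d x y = d y x,
      forall x y z, d x z <= d x y + d y z &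
      forall x : T, nbhs x =
        filter_from [set e : R | 0 < e] (fun e => [set y | d x y < e])].

(* Main.v *)
Require Import Defs.
From HB Require Import structures.
From mathcomp Require Import all_boot all_order all_algebra.
From mathcomp Require Import all_classical all_reals.
From mathcomp Require Import interval_inference ereal topology normedtype.
From mathcomp Require Import sequences convex.
From mathcomp Require Import lra.

Set Implicit Arguments.
Unset Strict Implicit.
Unset Printing Implicit Defensive.

Import Order.TTheory GRing.Theory Num.Theory.
Import numFieldNormedType.Exports.

Local Open Scope classical_set_scope.
Local Open Scope ring_scope.

(** The sets K_j are the open unit balls of an increasing sequence of seminorms,
    and this makes the theorem an instance of the construction of a metrizable
    locally convex topology from countably many seminorms.

    Any translation-invariant metric satisfies d(2v,0) <= 2 d(v,0), hence
    2 c(i+1) is contained in c(i) ([ccball_double]).  For a linear map A this says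
    that 2^i ||A||_{i,j} does not increase with i ([opnorm_double]).  Therefore
    p_j(A) := inf_{i>=1} 2^i ||A||_{i,j} is in fact a limit; it is subadditive
    because almost optimal indices for A and B can both be replaced by the larger
    one, and K_j = {p_j < 1} by definition of K_j.  The remaining points are:
    - p_j is finite, since tameness of A makes some ||A||_{i,j} finite
      ([TL_opnorm_fin]);
    - the p_j separate points ([tame_sn_separated]), the step that uses both
      strictness of V and local convexity of W.  Strictness puts a fixed multiple
      of 2^-i v into c(i) for all i at once, so p_j(A) = 0 forces A v into C(j);
      local convexity of W makes the intersection of the C(j) trivial;
    - a small distance between A and B in T_{r,b}L(V,W) makes
      ||A - B||_{M+r,M} small for any chosen M >= b, and taking M >= max(b, j)
      makes p_j(A - B) small ([TrbL_dist_lt_norm], [TrbL_TL_continuous]).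

    The general construction realizes the topology of an increasing separating
    sequence p_j by the translation-invariant metric
    sup_j min(2^-j, p_j(x - y)). *)

(** * Geometric series *)

Lemma half_pow_lt (R : realType) (e : R) : 0 < e -> exists j : nat, 2^-1 ^+ j < e.
Proof.
move=> e0; have := @cvg_expr R 2^-1.
rewrite ger0_norm ?invr_ge0// invf_lt1// ltr1n => /(_ erefl).
by move=> /cvgr_lt/(_ e e0)[j _ /(_ j (leqnn j))]; exists j.
Qed.

(** Finiteness of the sum matters here: [fine] sends an infinite sum to 0. *)
Lemma nneseries_half_term_le (R : realType) (f : nat -> R) b M :
  (forall n, 0 <= f n <= 2^-1 ^+ n) -> (b <= M)%N ->
  f M <= fine (\sum_(b <= n <oo) (f n)%:E)%E.
Proof.
move=> f01 bM.
have f0 n : (0 <= (f n)%:E)%E by rewrite lee_fin; case/andP: (f01 n).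
have partial n : \sum_(b <= k < n) f k <= 2 - 2 * 2^-1 ^+ n.
  elim: n => [|n ih]; first by rewrite big_geq// expr0; lra.
  have [bn|nb] := leqP b n.
    by rewrite big_nat_recr//= exprS; have /andP[_] := f01 n; move: ih; lra.
  have : 2^-1 ^+ n.+1 <= 1 :> R by rewrite exprn_ile1// invf_le1// ler1n.
  by rewrite big_geq//; lra.
rewrite -lee_fin fineK; last first.
  rewrite ge0_fin_numE; last by apply: nneseries_ge0.
  apply: (@le_lt_trans _ _ 2%:E); last exact: ltry.
  apply: lime_le; first exact: is_cvg_nneseries.
  apply: nearW => n; rewrite sumEFin lee_fin (le_trans (partial n))//.
  by rewrite gerBl mulr_ge0// exprn_ge0// invr_ge0.
apply: le_trans (nneseries_lim_ge M.+1 _) => //.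
by rewrite big_nat_recr//= leeDr// sume_ge0.
Qed.

(** * The topology of an increasing separating sequence of seminorms *)

Record seminorm_seq (R : realType) (E : lmodType R) := SeminormSeq {
  sn :> nat -> E -> R ;
  sn_ge0 : forall j x, 0 <= sn j x ;
  snD : forall j x y, sn j (x + y) <= sn j x + sn j y ;
  snZ : forall j (a : R) x, sn j (a *: x) <= `|a| * sn j x ;
  sn_mono : forall i j x, (i <= j)%N -> sn i x <= sn j x ;
  sn_separated : forall x, (forall j, sn j x = 0) -> x = 0
}.

(** A copy of the carrier that remembers the family of seminorms, so that the
    topology below is attached to the family and not to [E]. *)
Definition sn_space (R : realType) (E : lmodType R) (p : seminorm_seq E) : Type :=
  E.

Section SeminormTopology.
Context (R : realType) (E : lmodType R) (p : seminorm_seq E).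

(** Truncating at 2^-j makes the supremum finite and leaves only finitely many
    seminorms relevant at each scale, so that a single p_j controls it. *)
Definition frechet_norm (x : E) : R :=
  sup (range (fun j => Num.min (2^-1 ^+ j) (p j x))).

Definition frechet_dist (x y : E) : R := frechet_norm (x - y).

Let half_gt0 j : 0 < 2^-1 ^+ j :> R.
Proof. by rewrite exprn_gt0// invr_gt0. Qed.

Lemma sn0 j : p j 0 = 0.
Proof.
apply/eqP; rewrite eq_le sn_ge0 andbT -(scale0r (0 : E)).
by rewrite (le_trans (snZ _ _ _ _))// normr0 mul0r.
Qed.

Lemma snN j x : p j (- x) = p j x.
Proof.
have H y : p j (- y) <= p j y.
  by rewrite -scaleN1r (le_trans (snZ _ _ _ _))// normrN1 mul1r.
by apply/eqP; rewrite eq_le H /= -{1}[x]opprK H.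
Qed.

Lemma frechet_norm_ub j x : Num.min (2^-1 ^+ j) (p j x) <= frechet_norm x.
Proof.
apply: ub_le_sup; last by exists j.
exists 1 => _ [i _ <-]; rewrite ge_min; apply/orP; left.
by rewrite exprn_ile1// invf_le1// ler1n.
Qed.

Lemma frechet_norm_le x (e : R) :
  (forall j, Num.min (2^-1 ^+ j) (p j x) <= e) -> frechet_norm x <= e.
Proof.
move=> xe; apply: ge_sup.
  by exists (Num.min (2^-1 ^+ 0) (p 0 x)); exists 0.
by move=> _ [j _ <-].
Qed.

(** The seminorms before p_j are bounded by p_j, those after it by the
    truncation. *)
Lemma frechet_norm_le_half j x : p j x <= 2^-1 ^+ j -> frechet_norm x <= 2^-1 ^+ j.
Proof.
move=> xj; apply: frechet_norm_le => i; rewrite ge_min.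
have [ij|/ltnW ji] := leqP i j.
  by rewrite (le_trans (sn_mono p x ij) xj) orbT.
by rewrite ler_wiXn2l// invf_le1// ler1n.
Qed.

Lemma sn_lt_frechet j (e : R) x :
  frechet_norm x < Num.min (2^-1 ^+ j) e -> p j x < e.
Proof.
rewrite lt_min => /andP[xj xe].
have := frechet_norm_ub j x; rewrite ge_min => /orP[|/le_lt_trans]; last exact.
by move=> /le_lt_trans/(_ xj); rewrite ltxx.
Qed.

Lemma frechet_dist_eq0 x y : (frechet_dist x y == 0) = (x == y).
Proof.
apply/eqP/eqP => [xy0|->]; last first.
  apply/eqP; rewrite eq_le /frechet_dist subrr; apply/andP; split.
    by apply: frechet_norm_le => j; rewrite sn0 ge_min lexx orbT.
  by apply: le_trans (frechet_norm_ub 0 0); rewrite sn0 le_min lexx ltW.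
apply/eqP; rewrite -subr_eq0; apply/eqP/(@sn_separated _ _ p) => j.
apply/eqP; rewrite eq_le sn_ge0 andbT; apply/ler_addgt0Pr => e e0.
rewrite add0r ltW//; apply: sn_lt_frechet.
by rewrite [frechet_norm _]xy0 lt_min half_gt0.
Qed.

Lemma frechet_dist_sym x y : frechet_dist x y = frechet_dist y x.
Proof.
rewrite /frechet_dist /frechet_norm; congr sup; apply: eq_imagel => j _.
by rewrite -(opprB y x) snN.
Qed.

Lemma frechet_dist_triangle x y z :
  frechet_dist x z <= frechet_dist x y + frechet_dist y z.
Proof.
apply: frechet_norm_le => j.
apply: le_trans (lerD (frechet_norm_ub j (x - y)) (frechet_norm_ub j (y - z))).
have := snD p j (x - y) (y - z); rewrite subrKA.
have := half_gt0 j; have := sn_ge0 p j (x - y); have := sn_ge0 p j (y - z).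
move: (p j (x - z)) (p j (x - y)) (p j (y - z)) (2^-1 ^+ j) => a b c h.
(* truncation at h keeps nonnegative subadditivity: linear in each branch *)
by rewrite /Num.min; case: ifP => ?; case: ifP => ?; case: ifP => ? *; lra.
Qed.

Local Notation T := (sn_space p).

HB.instance Definition _ := Choice.copy T E.

Let ball (x : T) (e : R) : set T := [set y | frechet_dist x y < e].
Let ent : set_system (T * T) := entourage_ ball.

Let nbhs_entE : nbhs_ ent = nbhs_ ent. Proof. by []. Qed.

HB.instance Definition _ := hasNbhs.Build T (nbhs_ ent).

Let ball_center x (e : R) : 0 < e -> ball x e x.
Proof.
move=> e0; rewrite /ball/=.
by have /eqP -> : frechet_dist x x == 0 by rewrite frechet_dist_eq0.
Qed.

Let ball_sym x y (e : R) : ball x e y -> ball y e x.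
Proof. by rewrite /ball/= frechet_dist_sym. Qed.

Let ball_triangle x y z e1 e2 : ball x e1 y -> ball y e2 z -> ball x (e1 + e2) z.
Proof.
move=> xy yz; apply: le_lt_trans (frechet_dist_triangle x y z) _.
by rewrite ltrD.
Qed.

Let entE : ent = entourage_ ball. Proof. by []. Qed.

HB.instance Definition _ := @Nbhs_isPseudoMetric.Build R T
  ent nbhs_entE ball ball_center ball_sym ball_triangle entE.

Lemma sn_nbhs_dist (x : T) : nbhs x =
  filter_from [set e : R | 0 < e] (fun e => [set y | frechet_dist x y < e]).
Proof. by rewrite -filter_from_ballE. Qed.

(** The form in which the topology is used below: the metric is only needed to
    see that it is metrizable. *)
Lemma sn_nbhsP (x : T) (U : set T) : nbhs x U <->
  exists j (e : R), 0 < e /\ forall y : E, p j (y - (x : E)) < e -> U y.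
Proof.
rewrite sn_nbhs_dist; split=> [[e /= e0 eU]|[j [e [e0 eU]]]].
  have [j je] := half_pow_lt e0.
  exists j, (2^-1 ^+ j); split=> // y xy; apply: eU; apply: le_lt_trans je.
  by rewrite frechet_dist_sym; apply: frechet_norm_le_half; exact: ltW.
exists (Num.min (2^-1 ^+ j) e); first by rewrite /= lt_min half_gt0.
by move=> y /= xy; apply: eU; apply: sn_lt_frechet; rewrite [ltLHS]frechet_dist_sym.
Qed.

Lemma sn_add_continuous :
  continuous (fun z : T * T => (z.1 : E) + (z.2 : E) : T).
Proof.
move=> [x y] U /sn_nbhsP[j [e [e0 eU]]]/=.
have e20 : 0 < e / 2 by rewrite divr_gt0.
exists ([set z | p j ((z : E) - (x : E)) < e / 2],
        [set z | p j ((z : E) - (y : E)) < e / 2]).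
  by split; apply/sn_nbhsP; exists j, (e / 2).
move=> [u v] [/= ux vy]; apply: eU.
rewrite opprD addrACA; apply: le_lt_trans (snD _ _ _ _) _.
by rewrite [ltRHS](splitr e) ltrD.
Qed.

Lemma sn_scale_continuous :
  continuous (fun z : R^o * T => z.1 *: (z.2 : E) : T).
Proof.
move=> [a x] U /sn_nbhsP[j [e [e0 eU]]]/=.
have px1 : 0 < p j x + 1 by rewrite ltr_wpDl ?sn_ge0.
have a1 : 0 < `|a| + 1 by rewrite ltr_wpDl.
set d := Num.min 1 (e / 2 / (p j x + 1)).
have d0 : 0 < d by rewrite lt_min ltr01 !divr_gt0.
set s := e / 2 / (`|a| + 1).
have s0 : 0 < s by rewrite !divr_gt0.
exists ([set b | `|a - b| < d], [set z | p j ((z : E) - (x : E)) < s]).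
  split; last by apply/sn_nbhsP; exists j, s.
  by apply/nbhs_ballP; exists d.
move=> [b y] [/= ab yx]; apply: eU.
(* b y - a x = b (y - x) - (a - b) x, where |b| stays below |a| + 1 *)
have -> : b *: (y : E) - a *: (x : E) = b *: (y - x : E) - (a - b) *: (x : E).
  by rewrite scalerBr scalerBl opprB addrA subrK.
apply: le_lt_trans (snD _ _ _ _) _; rewrite snN.
have b1 : `|b| <= `|a| + 1.
  rewrite -[b](subKr a) (le_trans (ler_normB _ _))// lerD2l ltW//.
  by rewrite (lt_le_trans ab)// ge_min lexx.
rewrite [ltRHS](splitr e); apply: ltr_leD.
  apply: le_lt_trans (snZ _ _ _ _) _.
  apply: (@le_lt_trans _ _ ((`|a| + 1) * p j (y - x : E))).
    by rewrite ler_wpM2r ?sn_ge0.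
  by rewrite mulrC -ltr_pdivlMr.
apply: le_trans (snZ _ _ _ _) _.
apply: (@le_trans _ _ (e / 2 / (p j x + 1) * p j x)).
  rewrite ler_wpM2r ?sn_ge0// ltW// (lt_le_trans ab)//.
  by rewrite ge_min lexx orbT.
rewrite mulrAC ler_pdivrMr// ler_wpM2l ?lerDl//.
by rewrite divr_ge0// ltW.
Qed.

Lemma sn_hausdorff : hausdorff_space T.
Proof.
rewrite (@ball_hausdorff R) => x y xy.
have d0 : 0 < frechet_dist x y.
  rewrite lt_neqAle eq_sym frechet_dist_eq0 xy/=.
  apply: le_trans (frechet_norm_ub 0 _).
  by rewrite le_min sn_ge0 ltW.
have d20 : 0 < frechet_dist x y / 2 by rewrite divr_gt0.
exists (PosNum d20, PosNum d20); apply/eqP; rewrite -subset0 => z [/= xz yz].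
have := @ball_triangle x z y _ _ xz (ball_sym yz).
by rewrite /ball /= -splitr ltxx.
Qed.

Lemma sn_metrizable : metrizable R T.
Proof.
exists frechet_dist; split.
- exact: frechet_dist_eq0.
- exact: frechet_dist_sym.
- exact: frechet_dist_triangle.
- exact: sn_nbhs_dist.
Qed.

End SeminormTopology.

(** * Closed convex hulls of metric balls *)

Section ClosedConvexBalls.
Context (R : realType).

Lemma dist_ge0 (E : metricVectType R) (x : E) : 0 <= dist x 0.
Proof.
by have := dist_triangle x 0 0; rewrite distxx [dist 0 x]dist_sym; lra.
Qed.

Lemma ccball_min (E : metricVectType R) n (C : set E) :
  closed C -> convex_set C -> [set v : E | dist v 0 < 2^-1 ^+ n] `<=` C ->
  ccball E n `<=` C.
Proof.
move=> clC cC nC; rewrite (closure_id C).1//.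
by apply: closureS; exact: conv_hull_min.
Qed.

(** The triangle inequality and translation invariance give
    d(2v, 0) <= 2 d(v, 0); passing to closed convex hulls is harmless because
    the preimage of c(n) under doubling is closed and convex. *)
Lemma ccball_double (E : metricVectType R) n (x : E) :
  ccball E n.+1 x -> ccball E n (2 *: x).
Proof.
apply: (@ccball_min E n.+1 ( *:%R 2 @^-1` ccball E n)).
- apply: preimage_closed; last exact: closed_closure.
  by move=> y _; exact: (@cvg_scaler _ E 2 y).
- apply/convex_setP => t u v t01 /= cu cv.
  by rewrite scalerDr !scalerA ![2 * _]mulrC -!scalerA; exact: ccball_convex.
- move=> y /= yn; apply: sub_ccball.
  rewrite scaler_nat mulr2n; apply: le_lt_trans (dist_triangle y _ _) _.
  rewrite -[X in dist (y + y) X]add0r distDr.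
  by move: yn; rewrite exprS; lra.
Qed.

(** A convex neighborhood U of 0 within half the distance to w contains a metric
    ball, so its closure contains some C(j); but w is not in that closure. *)
Lemma ccball_separated (W : lcMetricVectType R) (w : W) :
  (forall j, ccball W j w) -> w = 0.
Proof.
move=> jw; apply: contrapT => /eqP w0.
have d0 : 0 < dist w 0.
  rewrite lt_neqAle dist_ge0 andbT eq_sym; apply: contra w0 => /eqP/dist_eq0 ->.
  exact: eqxx.
have d20 : 0 < dist w 0 / 2 by rewrite divr_gt0.
have [B cB [oB nB]] := @locally_convex R W.
have [|U [BU U0] Uw] := nB 0 [set y | dist 0 y < dist w 0 / 2].
  by rewrite nbhs_dist; exists (dist w 0 / 2).
have cU : convex_set U by apply: cB; rewrite inE.
have : nbhs 0 U by apply: open_nbhs_nbhs; split => //; exact: oB.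
rewrite nbhs_dist => -[e /= e0 eU].
have [j je] := half_pow_lt e0.
have : closure U w.
  apply: (ccball_min _ _ _ (jw j)); first exact: closed_closure.
    exact: closure_convex.
  move=> y /= yj; apply: subset_closure; apply: eU => /=.
  by rewrite dist_sym (lt_trans yj).
move=> /(_ [set y | dist w y < dist w 0 / 2])[].
  by rewrite nbhs_dist; exists (dist w 0 / 2).
move=> y [/Uw /= y0 wy]; have := dist_triangle y w 0.
by rewrite [dist y 0]dist_sym; lra.
Qed.

(** Strictness bounds d(tv, 0) linearly in t, so that a single S serves all
    radii 2^-i. *)
Lemma strict_ccball (V : metricVectType R) (v : V) : strict_metric V ->
  exists2 S : R, 0 < S & forall i, ccball V i ((2^-1 ^+ i / S) *: v).
Proof.
move=> /(_ v); set s := ereal_sup _ => sy.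
have ub r : 0 < r -> ((dist (r *: v) 0 / r)%:E <= s)%E.
  by move=> r0; apply: ereal_sup_ubound; exists r.
have sfin : s \is a fin_num.
  by rewrite fin_numElt sy (lt_le_trans (ltNyr _) (ub 1 ltr01)).
have S0 : 0 < fine s + 1.
  rewrite ltr_wpDl// -lee_fin fineK//; apply: le_trans (ub 1 ltr01).
  by rewrite lee_fin divr_ge0 ?dist_ge0.
(* the summand 1 makes S positive and the inequality strict *)
exists (fine s + 1) => // i; apply: sub_ccball.
have r0 : 0 < 2^-1 ^+ i / (fine s + 1) by rewrite divr_gt0// exprn_gt0// invr_gt0.
have := ub _ r0; rewrite -(fineK sfin) lee_fin ler_pdivrMr// => /le_lt_trans; apply.
by rewrite mulrCA gtr_pMr ?exprn_gt0 ?invr_gt0// ltr_pdivrMr// mul1r ltrDl.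
Qed.

End ClosedConvexBalls.

(** * The seminorms with unit balls K_j *)

Section TameSeminorm.
Context (R : realType) (V W : metricVectType R).
Implicit Types A B : TL V W.

Lemma TLZ A (a : R) (v : V) : A (a *: v) = a *: A v.
Proof.
have Alin : linear A by have := valP A; rewrite inE => -[r _ [b _ [[]]]].
have A0 : A 0 = 0.
  by have := Alin (-1) 0 0; rewrite !scaler0 addr0 scaleN1r addNr.
by rewrite -[a *: v]addr0 Alin A0 !addr0.
Qed.

(** By [opnorm_double] the infimum is the limit as i tends to infinity. *)
Definition tame_sn (j : nat) A : R :=
  fine (ereal_inf
    [set ((2 ^+ i)%:E * opnorm i j A)%E | i in [set i | (1 <= i)%N]]).

Lemma opnorm_double i j A : (opnorm i.+1 j A <= 2^-1%:E * opnorm i j A)%E.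
Proof.
have [fin|] := boolP (opnorm i j A \is a fin_num).
  rewrite -[in leRHS](@ger0_norm _ 2^-1)//; apply: muZ => // _ [x ix <-].
  exists (A (2 *: x)); first by exists (2 *: x) => //; exact: ccball_double.
  by rewrite TLZ scalerA mulVf// scale1r.
rewrite ge0_fin_numE ?mu_ge0// ltey negbK => /eqP ->.
by rewrite gt0_muley ?lte_fin ?invr_gt0// leey.
Qed.

(** For r = 1 this says that K_{i,j} increases with i, so that K_j is a directed
    union of convex sets. *)
Lemma opnorm_lt_mono i k j A (r : R) : (i <= k)%N ->
  (opnorm i j A < (r * 2^-1 ^+ i)%:E)%E -> (opnorm k j A < (r * 2^-1 ^+ k)%:E)%E.
Proof.
move=> /subnK <- ir; elim: (k - i)%N => [//|d ih].
rewrite addSn; apply: le_lt_trans (opnorm_double _ _ _) _.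
by rewrite exprS mulrCA EFinM lte_pmul2l// lte_fin invr_gt0.
Qed.

(** Tameness only speaks about the indices above b; since C(M) is contained in
    C(j) for M >= j, a bound for a larger M also serves j. *)
Lemma TL_opnorm_fin j A : exists2 i, (1 <= i)%N & opnorm i j A \is a fin_num.
Proof.
have := valP A; rewrite inE => -[r _ [b _ Arb]].
have := opnorm_fin Arb (leqW (leq_maxl b j)).
rewrite !ge0_fin_numE ?mu_ge0// => Afin.
exists ((maxn b j).+1 + r)%N; first by rewrite addSn.
rewrite ge0_fin_numE ?mu_ge0//; apply: le_lt_trans Afin.
by apply: mu_mono; rewrite leqW// leq_maxr.
Qed.

Lemma tame_sn_lt j A (r : R) : tame_sn j A < r <->
  exists2 i, (1 <= i)%N & (opnorm i j A < (r * 2^-1 ^+ i)%:E)%E.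
Proof.
have ge0 : (0 <= ereal_inf
    [set ((2 ^+ i)%:E * opnorm i j A)%E | i in [set i | (1 <= i)%N]])%E.
  apply: le_ereal_inf_tmp => _ [i _ <-].
  by rewrite mule_ge0 ?mu_ge0// lee_fin exprn_ge0.
rewrite -lte_fin /tame_sn fineK; last first.
  have [i i1 ifin] := TL_opnorm_fin j A.
  rewrite ge0_fin_numE//; apply: (@le_lt_trans _ _ ((2 ^+ i)%:E * opnorm i j A)%E).
    by apply: ereal_inf_lbound; exists i.
  by rewrite -ge0_fin_numE ?fin_numM// mule_ge0 ?mu_ge0// lee_fin exprn_ge0.
have iE i : ((2 ^+ i)%:E * opnorm i j A < r%:E)%E =
    (opnorm i j A < (r * 2^-1 ^+ i)%:E)%E.
  by rewrite mulrC EFinM exprVn lte_pdivlMl// exprn_gt0.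
split=> [/ereal_inf_lt[_ [i /= i1 <-]]|[i i1]]; first by rewrite iE; exists i.
rewrite -iE => ir; apply/ereal_inf_ltP.
by exists ((2 ^+ i)%:E * opnorm i j A)%E => //; exists i.
Qed.

Lemma tame_sn_le j A (r : R) :
  (forall e, 0 < e -> exists2 i, (1 <= i)%N &
    (opnorm i j A < ((r + e) * 2^-1 ^+ i)%:E)%E) ->
  tame_sn j A <= r.
Proof.
move=> rP; apply/ler_addgt0Pr => e e0; apply/ltW/tame_sn_lt.
exact: rP.
Qed.

Lemma K_jP j A : K_j j A <-> tame_sn j A < 1.
Proof.
split=> [[i /= i1 Ai]|/tame_sn_lt[i i1]].
  by apply/tame_sn_lt; exists i => //; rewrite mul1r.
by rewrite mul1r => Ai; exists i.
Qed.

Lemma tame_sn_ge0 j A : 0 <= tame_sn j A.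
Proof.
apply: fine_ge0; apply: le_ereal_inf_tmp => _ [i _ <-].
by rewrite mule_ge0 ?mu_ge0// lee_fin exprn_ge0.
Qed.

(** The norms of A and B at a common index are needed, and ||A||_{i,j} may be
    infinite at the smaller of the two; at the larger one [opnorm_lt_mono]
    preserves both bounds. *)
Lemma tame_snD j A B : tame_sn j (A + B) <= tame_sn j A + tame_sn j B.
Proof.
apply: tame_sn_le => e e0.
have e20 : 0 < e / 2 by rewrite divr_gt0.
have /tame_sn_lt[i i1 Ai] : tame_sn j A < tame_sn j A + e / 2 by rewrite ltrDl.
have /tame_sn_lt[k k1 Bk] : tame_sn j B < tame_sn j B + e / 2 by rewrite ltrDl.
exists (maxn i k); first by rewrite (leq_trans i1)// leq_maxl.
apply: le_lt_trans (opnormD _ _ _ _) _.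
rewrite [e](splitr e) addrACA mulrDl EFinD; apply: lteD.
  by apply: opnorm_lt_mono Ai; rewrite leq_maxl.
by apply: opnorm_lt_mono Bk; rewrite leq_maxr.
Qed.

Lemma tame_snZ j (a : R) A : tame_sn j (a *: A) <= `|a| * tame_sn j A.
Proof.
apply: tame_sn_le => e e0.
have a1 : 0 < `|a| + 1 by rewrite ltr_wpDl.
have d0 : 0 < e / (`|a| + 1) by rewrite divr_gt0.
have /tame_sn_lt[i i1 Ai] : tame_sn j A < tame_sn j A + e / (`|a| + 1).
  by rewrite ltrDl.
exists i => //.
have fin : opnorm i j A \is a fin_num.
  by rewrite ge0_fin_numE ?mu_ge0// (lt_trans Ai)// ltry.
apply: (@le_lt_trans _ _ (`|a|%:E * opnorm i j A)%E).
  by apply: muZ => // _ [x ix <-]; exists (A x) => //; exists x.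
apply: (@le_lt_trans _ _
  (`|a|%:E * ((tame_sn j A + e / (`|a| + 1)) * 2^-1 ^+ i)%:E)%E).
  by rewrite lee_wpmul2l ?lee_fin// ltW.
rewrite -EFinM lte_fin mulrA ltr_pM2r ?exprn_gt0 ?invr_gt0//.
rewrite mulrDr ltrD2l mulrCA gtr_pMr// ltr_pdivrMr// mul1r.
by rewrite ltrDl.
Qed.

Lemma tame_sn_mono i j A : (i <= j)%N -> tame_sn i A <= tame_sn j A.
Proof.
move=> ij; apply: tame_sn_le => e e0.
have /tame_sn_lt[k k1 Ak] : tame_sn j A < tame_sn j A + e by rewrite ltrDl.
by exists k => //; apply: le_lt_trans Ak; exact: mu_mono.
Qed.

End TameSeminorm.

(** * Comparison with the metric of T_{r,b}L(V,W) *)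

Section Comparison.
Context (R : realType) (V W : metricVectType R) (r b : nat).
Implicit Types A B : TrbL V W r b.

(** The M-th term of the series defining the distance is at most the distance,
    and x / (1 + x) is increasing. *)
Lemma TrbL_dist_lt_norm A B M (d : R) : (b <= M)%N -> 0 < d ->
  TrbL_dist A B < 2^-1 ^+ M * (d / (1 + d)) ->
  (TrbL_norm M (A - B)%R < d%:E)%E.
Proof.
move=> bM d0 ABd.
have fin : TrbL_norm M (A - B) \is a fin_num.
  by apply: opnorm_fin bM; have := valP (A - B); rewrite inE.
have norm0 n : 0 <= fine (TrbL_norm n (A - B)) by rewrite fine_ge0// mu_ge0.
rewrite -(fineK fin) lte_fin ltNge; apply/negP => dx.
suff : 2^-1 ^+ M * (d / (1 + d)) <= TrbL_dist A B by rewrite leNgt ABd.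
pose f n := 2^-1 ^+ n *
  (fine (TrbL_norm n (A - B)) / (1 + fine (TrbL_norm n (A - B)))).
apply: (@le_trans _ _ (f M)).
  rewrite ler_pM2l ?exprn_gt0 ?invr_gt0//.
  rewrite ler_pdivrMr ?addr_gt0// [leRHS]mulrAC ler_pdivlMr ?ltr_wpDr//.
  by rewrite !mulrDr !mulr1 [leRHS]addrC [leLHS]addrC [d * _]mulrC lerD2l.
apply: (@nneseries_half_term_le _ f) => // n.
rewrite /f mulr_ge0 ?exprn_ge0 ?invr_ge0 ?divr_ge0 ?addr_ge0//=.
rewrite ler_piMr ?exprn_ge0 ?invr_ge0//.
by rewrite ler_pdivrMr ?ltr_wpDr// mul1r lerDr.
Qed.

End Comparison.

(** * The topology on the tame linear maps *)

Section TameTopology.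
Context (R : realType) (V W : lcMetricVectType R) (strictV : strict_metric V).

(** If p_j(A) < 1/S, some i >= 1 has A(c(i)) inside s C(j) with s = 2^-i / S;
    since s v lies in c(i), it follows that A v lies in C(j). *)
Lemma tame_sn_separated (A : TL V W) : (forall j, tame_sn j A = 0) -> A = 0.
Proof.
move=> A0; apply: val_inj; apply/funext => v /=.
apply: ccball_separated => j.
have [S S0 Sv] := strict_ccball v strictV.
have /tame_sn_lt[i _] : tame_sn j A < S^-1 by rewrite A0 invr_gt0.
move=> /mu_ltP[s0 /(_ (A ((2^-1 ^+ i / S) *: v)))].
rewrite TLZ scalerA [_^-1 * _]mulrC [S^-1 * _]mulrC mulfV; last first.
  by rewrite gt_eqF// divr_gt0// exprn_gt0// invr_gt0.
rewrite scale1r; apply; exists ((2^-1 ^+ i / S) *: v); first exact: Sv.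
by rewrite TLZ.
Qed.

Definition tame_seminorms : seminorm_seq (TL V W) :=
  SeminormSeq (@tame_sn_ge0 R V W) (@tame_snD R V W) (@tame_snZ R V W)
    (fun i j A => @tame_sn_mono R V W i j A) tame_sn_separated.

Definition TL_topology : Topological.axioms_ (TL V W) :=
  Topological.class (sn_space tame_seminorms).

Let T : topologicalType := Topological.Pack TL_topology.

Lemma TL_nbhsP (A : TL V W) (U : set (TL V W)) : nbhs (A : T) U <->
  exists j (e : R), 0 < e /\ forall B, tame_sn j (B - A) < e -> U B.
Proof. exact: (@sn_nbhsP _ _ tame_seminorms). Qed.

Lemma TL_nbhs0 : nbhs ((0 : TL V W) : T) = filter_from (@K_base R V W) id.
Proof.
apply/seteqP; split=> U.
  move=> /TL_nbhsP[j [e [e0 eU]]].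
  have [n ne] := half_pow_lt e0.
  exists ( *:%R (2^-1 ^+ n) @` @K_j R V W j); first by exists n, j.
  move=> _ [A /K_jP Aj <-]; apply: eU; rewrite subr0.
  apply: le_lt_trans (tame_snZ _ _ _) (le_lt_trans _ ne).
  by rewrite ger0_norm ?exprn_ge0 ?invr_ge0// ler_piMr ?exprn_ge0 ?invr_ge0// ltW.
move=> [_ [n [j ->]] nU]; apply/TL_nbhsP; exists j, (2^-1 ^+ n).
split=> [|A]; first by rewrite exprn_gt0// invr_gt0.
rewrite subr0 exprVn => An; apply: nU; exists (2 ^+ n *: A).
  apply/K_jP; apply: le_lt_trans (tame_snZ _ _ _) _.
  by rewrite ger0_norm ?exprn_ge0// mulrC -ltr_pdivlMr ?exprn_gt0// mul1r.
by rewrite scalerA exprVn mulVf ?scale1r// expf_neq0.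
Qed.

Lemma K_base_countable : countable (@K_base R V W).
Proof.
have -> : @K_base R V W =
    (fun nj : nat * nat => *:%R (2^-1 ^+ nj.1) @` @K_j R V W nj.2) @` setT.
  apply/seteqP; split=> [N [n [j ->]]|_ [[n j] _ <-]]; first by exists (n, j).
  by exists n, j.
exact: (card_le_trans (card_image_le _ _) (countableP _)).
Qed.

Lemma TrbL_TL_continuous (r b : nat) :
  continuous (fun A : TrbL V W r b => TrbL_TL A : T).
Proof.
move=> A U /TL_nbhsP[j [e [e0 eU]]].
(* M >= b for [TrbL_dist_lt_norm], M >= j to compare C(M) with C(j), and M > 0
   since p_j only uses indices i >= 1 *)
pose M := (maxn b j).+1.
have d0 : 0 < e * 2^-1 ^+ (M + r) by rewrite mulr_gt0// exprn_gt0// invr_gt0.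
suff : nbhs A [set B | U (TrbL_TL B)] by [].
rewrite TrbL_nbhsE.
exists (2^-1 ^+ M * (e * 2^-1 ^+ (M + r) / (1 + e * 2^-1 ^+ (M + r)))).
  by rewrite /= mulr_gt0 ?exprn_gt0 ?invr_gt0// divr_gt0// addr_gt0.
move=> B /=; rewrite TrbL_dist_sym => /TrbL_dist_lt_norm BA; apply: eU.
apply/tame_sn_lt; exists (M + r)%N; first by rewrite addSn.
apply: le_lt_trans (BA _ d0); last by rewrite leqW// leq_maxl.
by apply: mu_mono; rewrite leqW// leq_maxr.
Qed.

End TameTopology.

Theorem theorem4p8 (R : realType) (V W : lcMetricVectType R) :
  strict_metric V ->
  exists t : Topological.axioms_ (TL V W),
    let T : topologicalType := Topological.Pack t in
    [/\ is_vector_topology t,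
        hausdorff_space T,
        countable (@K_base R V W) /\
          nbhs ((0 : TL V W) : T) = filter_from (@K_base R V W) id,
        metrizable R T
      & forall r b : nat,
          continuous (fun A : TrbL V W r b => TrbL_TL A : T) /\
          forall (A_ : nat -> TrbL V W r b) (A : TrbL V W r b),
            A_ n @[n --> \oo] --> A ->
            (TrbL_TL (A_ n) : T) @[n --> \oo] --> (TrbL_TL A : T)].
Proof.
move=> strictV; exists (TL_topology W strictV); split.
- by split; [exact: sn_add_continuous|exact: sn_scale_continuous].
- exact: sn_hausdorff.
- by split; [exact: K_base_countable|exact: TL_nbhs0].
- exact: sn_metrizable.
- move=> r b; split=> [|A_ A AA]; first exact: TrbL_TL_continuous.
  exact: cvg_comp AA (@TrbL_TL_continuous _ _ _ strictV r b A).
Qed.
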